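(* There is an absolute constant $C$ such that, for every $K\ge 1$, there exists an $\alpha=\alpha(K)>0$ with the following property. Let $\mathcal{H}$ be a nonempty, $r$-uniform, $K$-almost-regular, linear hypergraph with finite vertex set $V$, let $\varepsilon\coloneqq r/(4|V|)$, and suppose that $p\in(0,2/3]$ satisfies \[ (1-p)^r\cdot\Delta(\mathcal{H})\ge C\log|V| \qquad\text{and}\qquad p|V|\ge CK. \] Then, with positive probability, every $\varepsilon$-net for $\mathcal{H}(V_p)$ has cardinality at least $\alpha p|V|$.
   Context: A hypergraph on a finite vertex set $V$ is a family of subsets of $V$ (its edges); hypergraphs are identified with their edge sets, so nonempty means having at least one edge. It is $r$-uniform if every edge has exactly $r$ elements, and linear if any two distinct edges intersect in at most one vertex. The average vertex degree of $\mathcal{H}$ over all vertices of $V$ is denoted $d(\mathcal{H})$ (so $d(\mathcal{H})=r|\mathcal{H}|/|V|$ when $\mathcal{H}$ is $r$-uniform), and $\Delta(\mathcal{H})$ is the maximum vertex degree. For $K\ge1$, $\mathcal{H}$ is $K$-almost-regular if $\Delta(\mathcal{H})\le K\cdot d(\mathcal{H})$. For $R\subseteq V$, $\mathcal{H}(R)\coloneqq\{A\cap R : A\in\mathcal{H}\}$, regarded as a hypergraph with vertex set $R$. For $p\in(0,1]$, $V_p$ denotes the random subset of $V$ obtained by independently retaining each element of $V$ with probability $p$. For a hypergraph $\mathcal{G}$ on a finite vertex set $W$ and a real $\varepsilon>0$, an $\varepsilon$-net for $\mathcal{G}$ is a set $S\subseteq W$ that intersects every $A\in\mathcal{G}$ with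 $|A|\ge\varepsilon|W|$. Here $\log$ is the natural logarithm. *)

(* Defs.v *)
From HB Require Import structures.
From mathcomp Require Import all_boot all_order all_algebra.
From mathcomp Require Import reals exp.

Set Implicit Arguments.
Unset Strict Implicit.
Unset Printing Implicit Defensive.

Import Order.TTheory GRing.Theory Num.Theory.
Local Open Scope ring_scope.

(* A hypergraph with vertex set W, where W is a subset of a finite type V, is
   given by its set of edges, of type {set {set V}}.  The notions below that
   do not mention W are for hypergraphs whose vertex set is all of V. *)

Definition uniform (V : finType) (r : nat) (H : {set {set V}}) : Prop :=
  forall A, A \in H -> #|A| = r.

Definition linear_hypergraph (V : finType) (H : {set {set V}}) : Prop :=
  forall A B, A \in H -> B \in H -> A != B -> (#|A :&: B| <= 1)%N.

Definition degree (V : finType) (H : {set {set V}}) (v : V) : nat :=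
  #|[set A in H | v \in A]|.

Definition max_degree (V : finType) (H : {set {set V}}) : nat :=
  (\max_(v : V) degree H v)%N.

Definition avg_degree (R : realType) (V : finType) (H : {set {set V}}) : R :=
  (\sum_(v : V) degree H v)%N%:R / #|V|%:R.

Definition almost_regular (R : realType) (V : finType) (K : R)
    (H : {set {set V}}) : Prop :=
  (max_degree H)%:R <= K * avg_degree R H.

Definition trace_hypergraph (V : finType) (H : {set {set V}}) (W : {set V}) :
    {set {set V}} :=
  [set A :&: W | A in H].

Definition eps_net (R : realType) (V : finType) (eps : R) (W : {set V})
    (G : {set {set V}}) (S : {set V}) : bool :=
  (S \subset W) &&
  [forall A in G, (eps * #|W|%:R <= #|A|%:R) ==> (A :&: S != set0)].

(* Probability that V_p lies in E, where each v : V belongs to the random set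
   V_p with probability p, independently of the others. *)
Definition random_subset_prob (R : realType) (V : finType) (p : R)
    (E : pred {set V}) : R :=
  \sum_(W : {set V} | E W) \prod_(v : V) (if v \in W then p else 1 - p).

(* Main.v *)
Require Import Defs.
From HB Require Import structures.
From mathcomp Require Import all_boot all_order all_algebra.
From mathcomp Require Import reals sequences exp ring lra.

Set Implicit Arguments.
Unset Strict Implicit.
Unset Printing Implicit Defensive.

Import Order.TTheory GRing.Theory Num.Theory.
Local Open Scope ring_scope.

(* It suffices to exhibit one set W; take W p-random and write theta for
   (1 - p)^r Delta(H).  By linearity, for each vertex v the edges through v are
   disjoint off v, so with theta >= 4 log n no vertex lies in more than
   12 theta of the edges missing W, up to a small failure probability; by
   Markov's inequality a typical W is moreover missed by at least
   (1 - p)^r |H| / 8 edges.  Suppose every typical W contains a small net S.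
   The edges missing S include those missing W, so S depends on W only through
   the fact that some typical W0 contains it: fix such a W0 for each S.  The
   edges missing W0 form a nearly regular hypergraph missing S, and the net
   property says that the sum over v in W of the degrees in it is at most half
   of its expectation.  This event has probability exp(-c p n / K),
   independently of S being contained in W, and c / K beats the entropy of the
   choice of S inside W. *)

(** * Expectation over a [p]-random subset *)

Definition set_weight (R : realType) (V : finType) (p : R) (W : {set V}) : R :=
  \prod_(v : V) (if v \in W then p else 1 - p).

Definition expect (R : realType) (V : finType) (p : R) (f : {set V} -> R) : R :=
  \sum_(W : {set V}) set_weight p W * f W.

Lemma set_weight_ge0 (R : realType) (V : finType) (p : R) (W : {set V}) :
  0 <= p <= 1 -> 0 <= set_weight p W.
Proof.
by move=> /andP[p0 p1]; apply: prodr_ge0 => v _; case: ifP; rewrite ?subr_ge0.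
Qed.

Lemma set_weight_gt0 (R : realType) (V : finType) (p : R) (W : {set V}) :
  0 < p < 1 -> 0 < set_weight p W.
Proof.
by move=> /andP[p0 p1]; apply: prodr_gt0 => v _; case: ifP; rewrite ?subr_gt0.
Qed.

(** Independence of the vertices in algebraic form: expanding the right-hand product by choosing one
    summand per vertex lists the subsets [W]. *)
Lemma expect_prod (R : realType) (V : finType) (p : R) (f g : V -> R) :
  expect p (fun W => \prod_v (if v \in W then f v else g v)) =
  \prod_v (p * f v + (1 - p) * g v).
Proof.
rewrite (bigA_distr 1); apply: eq_bigr => W _; rewrite -big_split /=.
by apply: eq_bigr => v _; case: ifP.
Qed.

Lemma expect_le (R : realType) (V : finType) (p : R) (f g : {set V} -> R) :
  0 <= p <= 1 -> (forall W, f W <= g W) -> expect p f <= expect p g.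
Proof.
move=> p01 fg; apply: ler_sum => W _.
by apply: ler_wpM2l (fg W); exact: set_weight_ge0.
Qed.

Lemma expect_sum (R : realType) (V I : finType) (P : pred I) (p : R)
    (f : I -> {set V} -> R) :
  expect p (fun W => \sum_(i | P i) f i W) = \sum_(i | P i) expect p (f i).
Proof.
rewrite exchange_big /=; apply: eq_bigr => W _.
by rewrite mulr_sumr.
Qed.

Lemma expectD (R : realType) (V : finType) (p : R) (f g : {set V} -> R) :
  expect p (fun W => f W + g W) = expect p f + expect p g.
Proof. by rewrite -big_split /=; apply: eq_bigr => W _; rewrite mulrDr. Qed.

Lemma expectZ (R : realType) (V : finType) (p c : R) (f : {set V} -> R) :
  expect p (fun W => c * f W) = c * expect p f.
Proof. by rewrite mulr_sumr; apply: eq_bigr => W _; rewrite mulrCA. Qed.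

Lemma natr_forall (R : realType) (V : finType) (b : V -> bool) :
  [forall v, b v]%:R = \prod_v (b v)%:R :> R.
Proof.
case: (altP forallP) => [bT | /forallPn[v /negbTE bv]].
  by rewrite big1 // => v _; rewrite bT.
by rewrite (bigD1 v) //= bv mul0r.
Qed.

Lemma disjoint_forall (V : finType) (B W : {set V}) :
  [disjoint B & W] = [forall v, (v \in W) ==> (v \notin B)].
Proof.
apply/idP/forallP => [dBW v | dBW].
  by apply/implyP => vW; rewrite (disjointFl dBW vW).
apply/pred0P => v /=; apply/negbTE/negP => /andP[vB vW].
by have := dBW v; rewrite vW vB.
Qed.

Lemma natr_disjoint (R : realType) (V : finType) (B W : {set V}) :
  [disjoint B & W]%:R = \prod_v (if v \in W then (v \notin B)%:R else 1) :> R.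
Proof.
rewrite disjoint_forall natr_forall.
by apply: eq_bigr => v _; case: (v \in W).
Qed.

Lemma natr_subset (R : realType) (V : finType) (S W : {set V}) :
  (S \subset W)%:R = \prod_v (if v \in W then 1 else (v \notin S)%:R) :> R.
Proof.
have -> : (S \subset W) = [forall v, (v \notin W) ==> (v \notin S)].
  apply/subsetP/forallP => [sSW v | sSW v vS].
    by apply/implyP; apply/contra/sSW.
  by have := sSW v; rewrite vS implybF negbK.
by rewrite natr_forall; apply: eq_bigr => v _; case: (v \in W).
Qed.

Lemma expect_disjoint (R : realType) (V : finType) (p : R) (B : {set V}) :
  expect p (fun W => [disjoint B & W]%:R) = (1 - p) ^+ #|B|.
Proof.
under [expect _ _]eq_bigr do rewrite natr_disjoint.
rewrite [LHS](expect_prod p (fun v => (v \notin B)%:R) (fun=> 1)).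
rewrite (bigID (mem B)) /= [X in _ * X]big1 ?mulr1 => [|v ->]; last first.
  by rewrite ?mulr1n !mulr1 addrC subrK.
rewrite -prodr_const; apply: eq_bigr => v ->.
by rewrite mulr0 add0r.
Qed.

(** If [u \in B] the event is impossible, hence only an inequality; otherwise the two conditions
    concern different vertices and are independent. *)
Lemma expect_disjoint_mem (R : realType) (V : finType) (p : R) (B : {set V})
    (u : V) : 0 <= p <= 1 ->
  expect p (fun W => ([disjoint B & W] && (u \in W))%:R)
    <= p * (1 - p) ^+ #|B|.
Proof.
move=> /andP[p0 p1].
have [uB|uB] := boolP (u \in B).
  rewrite [X in X <= _]big1 ?mulr_ge0 ?exprn_ge0 ?subr_ge0 // => W _.
  case: (boolP [disjoint B & W]) => [dBW|]; last by rewrite mulr0.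
  by rewrite (disjointFr dBW uB) mulr0.
rewrite le_eqVlt; apply/orP; left; apply/eqP.
have -> : expect p (fun W => ([disjoint B & W] && (u \in W))%:R) =
  expect p (fun W => \prod_v (if v \in W then (v \notin B)%:R
                              else (v != u)%:R)).
  apply: eq_bigr => W _; congr (_ * _).
  rewrite -mulnb natrM natr_disjoint -sub1set natr_subset -big_split /=.
  by apply: eq_bigr => v _; rewrite inE; case: ifP; rewrite ?mulr1 ?mul1r.
rewrite expect_prod (bigD1 u) //= uB eqxx mulr0 addr0 mulr1; congr (_ * _).
rewrite (bigID (mem B)) /= [X in _ * X]big1 ?mulr1 => [|v /andP[-> ->]]; last first.
  by rewrite ?mulr1n !mulr1 addrC subrK.
rewrite -prodr_const; apply: eq_big => [v | v /andP[-> ->]].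
  by case: eqP => // ->; rewrite (negbTE uB).
by rewrite mulr0 add0r ?mulr1.
Qed.

Lemma sum_subset_expr (R : realType) (T : finType) (A : {set T}) (x : R) :
  \sum_(J : {set T} | J \subset A) x ^+ #|J| = (1 + x) ^+ #|A|.
Proof.
rewrite -prodr_const [RHS]big_mkcond /=.
have -> : \prod_i (if i \in A then 1 + x else 1) =
          \prod_i ((if i \in A then x else 0) + 1).
  by apply: eq_bigr => i _; case: ifP => _; rewrite ?add0r // addrC.
rewrite (bigA_distr 1) [LHS]big_mkcond /=; apply: eq_bigr => J _.
have [sJA | /subsetPn[i iJ iA]] := boolP (J \subset A); last first.
  by rewrite (bigD1 i) //= iJ (negbTE iA) mul0r.
rewrite -prodr_const [LHS]big_mkcond /=; apply: eq_bigr => i _.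
by case: ifP => // iJ; rewrite (subsetP sJA).
Qed.

(** * Edges missing a set, degree sums and linearity *)

Definition missing (V : finType) (H : {set {set V}}) (W : {set V}) :
    {set {set V}} := [set A in H | [disjoint A & W]].

Lemma sum_degree (V : finType) (H : {set {set V}}) (W : {set V}) :
  (\sum_(v in W) degree H v = \sum_(A in H) #|A :&: W|)%N.
Proof.
transitivity (\sum_(v in W) \sum_(A in H) (v \in A))%N.
  apply: eq_bigr => v _; rewrite /degree -sum1_card big_mkcond [RHS]big_mkcond.
  by apply: eq_bigr => A _; rewrite inE; case: (A \in H).
rewrite exchange_big /=; apply: eq_bigr => A _.
rewrite -sum1_card big_mkcond [RHS]big_mkcond.
by apply: eq_bigr => v _; rewrite inE andbC; case: (v \in W).
Qed.

Lemma sum_degree_uniform (V : finType) (r : nat) (H : {set {set V}}) :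
  uniform r H -> (\sum_(v : V) degree H v = r * #|H|)%N.
Proof.
move=> Hr; have := sum_degree H setT.
rewrite (eq_bigl xpredT) => [->|v]; last by rewrite inE.
rewrite mulnC -sum_nat_const; apply: eq_bigr => A AH.
by rewrite setIT Hr.
Qed.

Lemma degree_missing0 (V : finType) (H : {set {set V}}) (W : {set V}) v :
  v \in W -> degree (missing H W) v = 0%N.
Proof.
move=> vW; apply/eqP; rewrite cards_eq0; apply/eqP/setP => A.
rewrite !inE; apply/negbTE/negP => /andP[/andP[_ dAW] vA].
by rewrite (disjointFr dAW vA) in vW.
Qed.

Lemma missing_antimono (V : finType) (H : {set {set V}}) (S W : {set V}) :
  S \subset W -> missing H W \subset missing H S.
Proof.
move=> sSW; apply/subsetP => A; rewrite !inE => /andP[-> /=].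
exact/disjointWr.
Qed.

Lemma linear_eq (V : finType) (H : {set {set V}}) (A B : {set V}) (u v : V) :
  linear_hypergraph H -> A \in H -> B \in H -> u != v ->
  u \in A -> v \in A -> u \in B -> v \in B -> A = B.
Proof.
move=> linH AH BH uv uA vA uB vB; apply/eqP/negPn/negP => AB.
have := linH A B AH BH AB; rewrite leqNgt => /negP; apply.
have <- : #|[set u; v]| = 2%N by rewrite cards2 uv.
apply/subset_leq_card/subsetP => x.
by rewrite !inE => /orP[] /eqP->; apply/andP.
Qed.

(** Send each edge through [v] to one of its other vertices, or to [v] itself if the edge is
    [[set v]]; linearity makes this map injective. *)
Lemma degree_le_card (V : finType) (H : {set {set V}}) (v : V) :
  linear_hypergraph H -> (degree H v <= #|V|)%N.
Proof.
move=> linH; pose f (A : {set V}) := odflt v [pick u in A :\ v].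
have fP (A : {set V}) : v \in A ->
    (f A != v /\ f A \in A) \/ (f A = v /\ A = [set v]).
  move=> vA; rewrite /f; case: pickP => [u | A0] /=.
    by rewrite !inE => /andP[]; left.
  right; split=> //; apply/setP => x; rewrite inE; have [-> //|xv] := eqVneq.
  by have := A0 x; rewrite !inE xv.
rewrite /degree -(@card_in_imset _ _ f) ?max_card // => A B.
rewrite !inE => /andP[AH vA] /andP[BH vB] fAB.
case: (fP A vA) (fP B vB) => -[fA1 fA2] [] [fB1 fB2].
- by apply: (linear_eq linH AH BH fA1) => //; rewrite fAB.
- by rewrite fAB fB1 eqxx in fA1.
- by rewrite -fAB fA1 eqxx in fB1.
- by rewrite fA2 fB2.
Qed.

(* Two edges through v share no other vertex, so the sets A :\ v with A in J
   are pairwise disjoint. *)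
Lemma linear_star_card (V : finType) (r : nat) (H J : {set {set V}}) (v : V) :
  linear_hypergraph H -> uniform r H -> J \subset [set A in H | v \in A] ->
  (r.-1 * #|J| <= #|\bigcup_(A in J) (A :\ v)|)%N.
Proof.
move=> linH Hr sJ.
have JP A : A \in J -> A \in H /\ v \in A.
  by move=> /(subsetP sJ); rewrite inE => /andP[].
have -> : (r.-1 * #|J| = \sum_(A in J) #|A :&: [set~ v]|)%N.
  rewrite mulnC -sum_nat_const; apply: eq_bigr => A /JP[AH vA].
  by rewrite -setDE -(Hr A AH) (cardsD1 v A) vA.
rewrite -sum_degree -sum1_card.
rewrite [X in (X <= _)%N]big_mkcond [X in (_ <= X)%N]big_mkcond.
apply: leq_sum => u _; rewrite !inE; case: eqVneq => //= uv.
have [E | [A]] := set_0Vmem [set A in J | u \in A].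
  by rewrite /degree E cards0.
rewrite inE => /andP[AJ uA]; have [AH vA] := JP A AJ.
have -> : (u \in \bigcup_(A in J) (A :\ v)).
  by apply/bigcupP; exists A => //; rewrite !inE uv.
rewrite /degree -(cards1 A); apply/subset_leq_card/subsetP => B.
rewrite !inE => /andP[BJ uB]; have [BH vB] := JP B BJ.
exact/eqP/(linear_eq linH BH AH uv).
Qed.

(** * Exponential moment bounds *)

(** The power of 2 counts the sets [J] of edges through [v] that all miss [W]. For a given [J], the
    union of the [A :\ v] must miss [W]; it has at least [r.-1 * #|J|] vertices, so summing over [J]
    gives a binomial expansion. *)
Lemma expect_exp_degree_missing (R : realType) (V : finType) (r : nat)
    (H : {set {set V}}) (p : R) (v : V) :
  linear_hypergraph H -> uniform r H -> 0 <= p <= 1 ->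
  expect p (fun W => 2 ^+ degree (missing H W) v)
    <= (1 + (1 - p) ^+ r.-1) ^+ degree H v.
Proof.
move=> linH Hr p01; pose star := [set A in H | v \in A].
have q01 : 0 <= 1 - p <= 1 by move: p01; lra.
apply: (@le_trans _ _ (expect p (fun W => \sum_(J : {set {set V}} | J \subset star)
   [disjoint \bigcup_(A in J) (A :\ v) & W]%:R))).
  apply: expect_le => // W; pose Y := [set A in missing H W | v \in A].
  rewrite -natrX -/(degree _ _) /degree -/Y -card_powerset -sum1_card.
  rewrite (eq_bigl (fun J : {set {set V}} => J \subset Y)) => [|J]; last first.
    by rewrite powersetE.
  rewrite natr_sum [leLHS]big_mkcond [leRHS]big_mkcond.
  apply: ler_sum => J _; case: ifP => sJY; last by case: ifP.
  have YP A : A \in Y -> [/\ A \in H, v \in A & [disjoint A & W]].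
    by rewrite !inE => /andP[/andP[? ?] ?].
  have -> : J \subset star.
    apply: (subset_trans sJY); apply/subsetP => A /YP[AH vA _].
    by rewrite inE AH.
  suff -> : [disjoint \bigcup_(A in J) (A :\ v) & W] by [].
  rewrite -setI_eq0 -subset0; apply/subsetP => x.
  rewrite inE => /andP[/bigcupP[A /(subsetP sJY)/YP[_ _ dAW]]].
  by rewrite !inE => /andP[_ xA]; rewrite (disjointFr dAW xA).
rewrite expect_sum -/star [degree H v]/degree -/star -sum_subset_expr.
apply: ler_sum => J sJ; rewrite expect_disjoint -exprM.
by apply: ler_wiXn2l (linear_star_card linH Hr sJ); case/andP: q01.
Qed.

(** [expR (- x)] is at most [1 / (1 + x)], and for nonnegative [x] the product
    [(1 + x) * (1 - 3 / 4 * x)] is at least 1 exactly up to [x = 1 / 3]. *)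
Lemma expRN_le (R : realType) (x : R) :
  0 <= x <= 1 / 3 -> expR (- x) <= 1 - 3 / 4 * x.
Proof.
move=> x01; have e1 := expR_ge1Dx x; rewrite expRN.
have x1 : 0 < 1 + x by lra.
apply: (@le_trans _ _ (1 + x)^-1); first by rewrite lef_pV2 ?posrE ?expR_gt0.
rewrite -[_^-1]mul1r ler_pdivrMr //; nra.
Qed.

(** As [d] vanishes on [S], containing [S] and the exponential weight depend on different vertices,
    so the expectation factors. A vertex outside [S] contributes [1 - p + p * expR (- d v)], bounded
    through [expRN_le] and [1 - y <= expR (- y)]. *)
Lemma expect_subset_expR (R : realType) (V : finType) (p : R) (S : {set V})
    (d : V -> R) :
  0 <= p <= 1 -> (forall v, v \in S -> d v = 0) ->
  (forall v, 0 <= d v <= 1 / 3) ->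
  expect p (fun W => (S \subset W)%:R * expR (- \sum_(v in W) d v))
    <= p ^+ #|S| * expR (- (3 / 4 * p * \sum_v d v)).
Proof.
move=> p01 dS d01.
have -> : expect p (fun W => (S \subset W)%:R * expR (- \sum_(v in W) d v)) =
    expect p (fun W => \prod_v (if v \in W then expR (- d v)
                                else (v \notin S)%:R)).
  apply: eq_bigr => W _; congr (_ * _); rewrite natr_subset -sumrN expR_sum.
  rewrite [X in _ * X]big_mkcond -big_split /=.
  by apply: eq_bigr => v _; case: ifP; rewrite ?mul1r ?mulr1.
rewrite expect_prod -prodr_const mulr_sumr -sumrN expR_sum.
rewrite [X in _ <= X * _]big_mkcond -big_split /=; apply: ler_prod => v _.
have e0 := expR_gt0 (- d v); case: ifP => vS /=.
  rewrite dS // !mulr0 oppr0 expR0 ?mulr1 ?addr0.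
  by move: p01; lra.
have := expRN_le (d01 v); have := expR_ge1Dx (- (3 / 4 * p * d v)).
move: p01 => /andP[p0 p1] ea eb; apply/andP; split; first by nra.
rewrite mul1r mulr1; apply: le_trans ea; nra.
Qed.

Lemma natr_bool_le (R : realType) (b : bool) (x : R) :
  0 <= x -> (b -> 1 <= x) -> b%:R <= x.
Proof. by move=> x0; case: b => // ->. Qed.

(* 2 ^ d is compared with e ^ (d / 2), whence the threshold 12. *)
Lemma expect_degree_missing_gt (R : realType) (V : finType) (r : nat)
    (H : {set {set V}}) (p theta : R) (v : V) :
  linear_hypergraph H -> uniform r H -> (0 < r)%N -> 0 < p -> p <= 2 / 3 ->
  theta = (1 - p) ^+ r * (max_degree H)%:R ->
  expect p (fun W => (12 * theta < (degree (missing H W) v)%:R)%R%:R)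
    <= expR (- (3 * theta)).
Proof.
move=> linH Hr r0 p0 p23 thetaE.
have p01 : 0 <= p <= 1 by lra.
have e2 : expR (2^-1 : R) <= 2.
  have := expR_ge1Dx (- 2^-1 : R); rewrite expRN => e1.
  have e0 := expR_gt0 (2^-1 : R).
  rewrite -[X in X <= _]invrK -[X in _ <= X]invrK lef_pV2 ?posrE ?invr_gt0 //.
  by lra.
apply: (@le_trans _ _ (expect p (fun W =>
    expR (- (6 * theta)) * 2 ^+ degree (missing H W) v))).
  apply: expect_le => // W; set d := degree _ _.
  apply: natr_bool_le => [|dM]; first by rewrite mulr_ge0 ?expR_ge0 ?exprn_ge0.
  rewrite mulrC expRN ler_pdivlMr ?expR_gt0 // mul1r.
  apply: (@le_trans _ _ (expR (2^-1) ^+ d)); last first.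
    by apply: lerXn2r; rewrite ?nnegrE ?expR_ge0.
  rewrite -expRM_natl ler_expR; lra.
rewrite expectZ.
have q0 : 0 <= 1 - p by lra.
have x0 : 0 <= (1 - p) ^+ r.-1 by exact: exprn_ge0.
have degD : (degree H v <= max_degree H)%N by exact: leq_bigmax.
apply: (@le_trans _ _ (expR (- (6 * theta)) * expR (3 * theta))); last first.
  by rewrite -expRD ler_expR; lra.
rewrite ler_pM2l ?expR_gt0 //.
apply: le_trans (expect_exp_degree_missing v linH Hr p01) _.
apply: (@le_trans _ _ (expR ((1 - p) ^+ r.-1) ^+ degree H v)).
  by apply: lerXn2r; rewrite ?nnegrE ?expR_ge0 ?addr_ge0 ?expR_ge1Dx.
rewrite -expRM_natl ler_expR.
(* Replacing the exponent [r.-1] by [r] costs a factor [1 / (1 - p)], at most 3 because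
   [p <= 2 / 3]. *)
have -> : theta = (1 - p) * (1 - p) ^+ r.-1 * (max_degree H)%:R.
  by rewrite thetaE -exprS prednK.
have : ((degree H v)%:R : R) <= (max_degree H)%:R by rewrite ler_nat.
have : (0 : R) <= (degree H v)%:R by rewrite ler0n.
move: (_ ^+ _) x0 => x x0; move: (degree H v)%:R (max_degree H)%:R => a b a0 ab.
have : a * x <= b * x by rewrite ler_wpM2r.
have : 0 <= (2 / 3 - p) * (b * x) by rewrite mulr_ge0 ?subr_ge0 ?mulr_ge0 //; lra.
nra.
Qed.

(** * Typical sets and their probability *)

(** The last bound is what turns the net threshold [eps * #|W|%:R] into at most [r%:R * p / 2], half
    the mean size of the trace of an edge. *)
Definition typical (R : realType) (V : finType) (r : nat) (H : {set {set V}})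
    (p : R) (W : {set V}) : bool :=
  [&& [forall v, (degree (missing H W) v)%:R
                   <= 12 * ((1 - p) ^+ r * (max_degree H)%:R)],
      (1 - p) ^+ r * #|H|%:R / 8 <= #|missing H W|%:R
    & #|W|%:R <= 2 * p * #|V|%:R].

Lemma almost_regular_edges (R : realType) (V : finType) (r : nat) (K : R)
    (H : {set {set V}}) :
  uniform r H -> almost_regular K H -> (0 < #|V|)%N ->
  #|V|%:R * (max_degree H)%:R <= K * (r%:R * #|H|%:R).
Proof.
move=> Hr; rewrite /almost_regular /avg_degree (sum_degree_uniform Hr) natrM.
by move=> HK n0; rewrite mulrC -ler_pdivlMr ?ltr0n // -mulrA.
Qed.

Lemma card_missing (R : realType) (V : finType) (H : {set {set V}}) W :
  #|missing H W|%:R = \sum_(A in H) [disjoint A & W]%:R :> R.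
Proof.
rewrite -sum1_card natr_sum big_mkcond [RHS]big_mkcond.
by apply: eq_bigr => A _; rewrite inE; case: (A \in H) => //=; case: ifP.
Qed.

Lemma expect_card_missing (R : realType) (V : finType) (r : nat)
    (H : {set {set V}}) (p : R) :
  uniform r H ->
  expect p (fun W => #|missing H W|%:R) = (1 - p) ^+ r * #|H|%:R.
Proof.
move=> Hr; under [expect _ _]eq_bigr do rewrite card_missing.
rewrite -/(expect p (fun W => \sum_(A in H) [disjoint A & W]%:R)) expect_sum.
rewrite (eq_bigr (fun=> (1 - p) ^+ r)) => [|A AH].
  by rewrite sumr_const mulr_natr.
by rewrite expect_disjoint Hr.
Qed.

(** Prepares a Markov bound: it limits the part of the mean of [#|missing H W|] that comes from sets
    [W] larger than twice their mean size. *)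
Lemma expect_card_missingM (R : realType) (V : finType) (r : nat)
    (H : {set {set V}}) (p : R) :
  uniform r H -> 0 <= p <= 1 ->
  expect p (fun W => #|missing H W|%:R * #|W|%:R)
    <= (1 - p) ^+ r * #|H|%:R * (p * #|V|%:R).
Proof.
move=> Hr p01.
have -> : expect p (fun W => #|missing H W|%:R * #|W|%:R) =
    expect p (fun W => \sum_(A in H) \sum_(u : V)
      ([disjoint A & W] && (u \in W))%:R).
  apply: eq_bigr => W _; congr (_ * _); rewrite card_missing mulr_suml.
  apply: eq_bigr => A _; rewrite -sum1_card natr_sum big_mkcond mulr_sumr.
  by apply: eq_bigr => u _; rewrite -mulnb natrM; case: (u \in W).
rewrite expect_sum.
apply: (@le_trans _ _ (\sum_(A in H) \sum_(u : V) p * (1 - p) ^+ r)).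
  apply: ler_sum => A AH; rewrite expect_sum; apply: ler_sum => u _.
  by rewrite -(Hr A AH); exact: expect_disjoint_mem.
rewrite !sumr_const -[X in X <= _]mulr_natr -[X in X * _ <= _]mulr_natr.
by rewrite le_eqVlt; apply/orP; left; apply/eqP; ring.
Qed.

(** The mean [mu] of the number of missing edges is split by the reason why [W] may fail to be
    typical. Few missing edges account for at most [mu / 8], a large [W] for [mu / 2], a large
    degree for [mu / 4]. The remaining [mu / 8] comes from typical sets, each contributing at most
    [12 * K * mu]. *)
Lemma expect_typical (R : realType) (V : finType) (r : nat)
    (H : {set {set V}}) (p K : R) :
  linear_hypergraph H -> uniform r H -> almost_regular K H -> H != set0 ->
  0 < p -> p <= 2 / 3 -> (4 <= #|V|)%N ->
  let theta : R := (1 - p) ^+ r * (max_degree H)%:R in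
  1 <= theta -> #|V|%:R <= expR theta -> 0 <= K ->
  1 <= 96 * K * expect p (fun W => (typical r H p W)%:R).
Proof.
move=> linH Hr HK H0 p0 p23 n4 theta theta1 ntheta K0.
have p01 : 0 <= p <= 1 by lra.
have n0 : (0 < #|V|)%N by exact: leq_trans n4.
have n4R : 4 <= #|V|%:R :> R by rewrite ler_nat.
have h0 : 0 < #|H|%:R :> R by rewrite ltr0n card_gt0.
have nD := almost_regular_edges Hr HK n0.
have q0 : 0 < (1 - p) ^+ r by rewrite exprn_gt0 //; lra.
set q := (1 - p) ^+ r in q0 theta theta1 ntheta *.
set n : R := #|V|%:R in n4R ntheta nD *.
set h : R := #|H|%:R in h0 nD *.
pose mu := q * h; have mu0 : 0 < mu by rewrite mulr_gt0.
have r0 : (0 < r)%N.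
  rewrite lt0n; apply/eqP => r0; move: nD; rewrite r0 mul0r mulr0.
  move: theta1; rewrite /theta; have : 0 <= (max_degree H)%:R :> R by [].
  move: (max_degree H)%:R => D D0; nra.
have rR : 0 < r%:R :> R by rewrite ltr0n.
have nthetaK : n * theta <= K * (r%:R * mu).
  have -> : n * theta = q * (n * (max_degree H)%:R) by rewrite /theta; ring.
  have -> : K * (r%:R * mu) = q * (K * (r%:R * h)) by rewrite /mu; ring.
  by rewrite ler_wpM2l // ltW.
have Dn : (max_degree H)%:R <= n.
  rewrite ler_nat; apply/bigmax_leqP => v _; exact: degree_le_card.
(* Since the maximum degree is at most [n], [theta >= 1] forces [q * n >= 1], so [n <= q * n * n];
   and [4 * n * n] is at most [expR theta ^+ 3]. *)
have tail : n * expR (- (3 * theta)) <= q / 4.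
  have qn : 1 <= q * n by apply: le_trans theta1 _; rewrite ler_wpM2l // ltW.
  rewrite expRN -[3 * theta]/(3%:R * theta) expRM_natl.
  set E := expR theta in ntheta *; have E0 : 0 < E by lra.
  rewrite ler_pdivrMr ?exprn_gt0 //.
  have nE : n * n * 4 <= E ^+ 3.
    rewrite !exprS expr0 mulr1 mulrA.
    have nn : n * n <= E * E by apply: ler_pM => //; lra.
    by apply: ler_pM nn _ => //; [rewrite mulr_ge0 //; lra | lra].
  have : q * (n * n * 4) <= q * E ^+ 3 by rewrite ler_wpM2l // ltW.
  nra.
set P := expect _ _.
have ptw : expect p (fun W => #|missing H W|%:R) <=
   expect p (fun W => 12 * K * mu * (typical r H p W)%:R + (mu / 8 * 1 +
     ((2 * p * n)^-1 * (#|missing H W|%:R * #|W|%:R) +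
      h * \sum_(v : V) (12 * theta < (degree (missing H W) v)%:R)%R%:R))).
  apply: expect_le => // W; set g : R := #|missing H W|%:R.
  have pn0 : 0 < 2 * p * n by rewrite !mulr_gt0 //; lra.
  have g0 : 0 <= g by exact: ler0n.
  have c0 : 0 <= (2 * p * n)^-1 * (g * #|W|%:R).
    by rewrite !mulr_ge0 ?invr_ge0 // ltW.
  have s0 : 0 <= h * \sum_(v : V)
      (12 * theta < (degree (missing H W) v)%:R)%R%:R.
    by rewrite mulr_ge0 ?sumr_ge0 // ltW.
  have t0 : 0 <= 12 * K * mu * (typical r H p W)%:R.
    by rewrite !mulr_ge0 // ltW.
  have [a1|/forallPn[v]] := boolP [forall v, (degree (missing H W) v)%:R
                   <= 12 * theta]; last first.
    rewrite -ltNge => av.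
    suff : g <= h * \sum_(v : V)
        (12 * theta < (degree (missing H W) v)%:R)%R%:R by lra.
    apply: (@le_trans _ _ (h * 1)).
      rewrite mulr1 ler_nat; apply/subset_leq_card/subsetP => A.
      by rewrite inE => /andP[].
    apply: ler_wpM2l; first exact: ltW.
    by rewrite (bigD1 v) //= av lerDl sumr_ge0.
  have [a3|a3] := lerP (#|W|%:R) (2 * p * n); last first.
    suff : g <= (2 * p * n)^-1 * (g * #|W|%:R) by lra.
    by rewrite mulrC ler_pdivlMr // ler_wpM2l // ltW.
  have [a2|a2] := lerP (mu / 8) g; last by lra.
  have -> : (typical r H p W)%:R = 1 :> R.
    by have -> : typical r H p W by apply/and3P.
  suff : g <= 12 * K * mu by lra.
  (* Double counting incidences: the degree cap limits the number of missing edges, and [nthetaK]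
     turns the cap into a multiple of [mu]. *)
  have : r%:R * g <= n * (12 * theta).
    have Mr : uniform r (missing H W) by move=> A; rewrite inE => /andP[/Hr].
    rewrite -natrM -(sum_degree_uniform Mr) natr_sum.
    apply: (@le_trans _ _ (\sum_(v : V) (12 * theta))).
      by apply: ler_sum => v _; exact: (forallP a1).
    by rewrite sumr_const -[X in X <= _]mulr_natl.
  move=> rg; rewrite -(ler_pM2l rR); nra.
have := ptw; rewrite !expectD !expectZ expect_sum (expect_card_missing p Hr) -/P.
have -> : expect p (fun _ : {set V} => 1) = 1.
  rewrite -[RHS](expr0 (1 - p)) -(cards0 V) -expect_disjoint.
  by apply: eq_bigr => W _; rewrite disjoints_subset sub0set.
have third : (2 * p * n)^-1 * expect p (fun W => #|missing H W|%:R * #|W|%:R)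
    <= mu / 2.
  rewrite mulrC ler_pdivrMr ?mulr_gt0 //; try lra.
  apply: le_trans (expect_card_missingM Hr p01) _.
  by rewrite -/q -/n -/h -/mu; lra.
have fourth : h * \sum_v expect p (fun W : {set V} =>
    (12 * theta < (degree (missing H W) v)%:R)%R%:R) <= mu / 4.
  apply: (@le_trans _ _ (h * (n * expR (- (3 * theta))))).
    apply: ler_wpM2l; first exact: ltW.
    have -> : n * expR (- (3 * theta)) = \sum_(v : V) expR (- (3 * theta)).
      by rewrite sumr_const -[RHS]mulr_natl.
    by apply: ler_sum => v _; exact: (expect_degree_missing_gt v linH Hr r0 p0 p23 erefl).
  have -> : mu / 4 = h * (q / 4) by rewrite /mu; field.
  by apply: ler_wpM2l tail; exact: ltW.
rewrite -/q -/h -/mu => main.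
have : mu * 1 <= mu * (96 * K * P) by lra.
by rewrite ler_pM2l.
Qed.

(** * Probability bound for one candidate net *)

(** An exponential Markov bound for the degree sum over [W] in the hypergraph [G] of edges missing a
    fixed typical [W0] containing [S]. The degrees in [G] vanish on [S], so the cost [p ^+ #|S|] of
    containing [S] is kept in full. *)
Lemma expect_subset_hitting (R : realType) (V : finType) (r : nat)
    (H : {set {set V}}) (p K : R) (S : {set V}) :
  uniform r H -> almost_regular K H -> 0 < p -> p < 1 ->
  0 < K -> (0 < #|V|)%N -> (0 < max_degree H)%N ->
  expect p (fun W => [&& S \subset W, typical r H p W &
      [forall A in missing H S, #|A :&: W|%:R <= r%:R * p / 2]]%:R)
    <= p ^+ #|S| * expR (- (p * #|V|%:R / (1152 * K))).
Proof.
move=> Hr HK p0 p1 K0 n0 D0.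
have p01 : 0 <= p <= 1 by rewrite !ltW.
have [/existsP[W0 /andP[sSW0 typW0]] | noW0] :=
    boolP [exists W : {set V}, (S \subset W) && typical r H p W]; last first.
  rewrite [X in X <= _]big1 ?mulr_ge0 ?exprn_ge0 ?ltW ?expR_gt0 // => W _.
  suff /negbTE -> : ~~ [&& S \subset W, typical r H p W &
      [forall A in missing H S, #|A :&: W|%:R <= r%:R * p / 2]].
    by rewrite mulr0.
  apply: contra noW0 => /and3P[sSW typW _].
  by apply/existsP; exists W; rewrite sSW.
have q0 : 0 < (1 - p) ^+ r by rewrite exprn_gt0 // subr_gt0.
pose theta : R := (1 - p) ^+ r * (max_degree H)%:R.
have theta0 : 0 < theta by rewrite mulr_gt0 ?ltr0n.
case/and3P: typW0 => /forallP dle gge _; rewrite -/theta in dle.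
set G := missing H W0 in dle gge.
have Gr : uniform r G by move=> A; rewrite inE => /andP[/Hr].
pose m : R := r%:R * #|G|%:R.
have mE : m = \sum_(v : V) (degree G v)%:R.
  by rewrite /m -natrM -(sum_degree_uniform Gr) natr_sum.
have m_ge : #|V|%:R * theta / (8 * K) <= m.
  have := almost_regular_edges Hr HK n0.
  rewrite ler_pdivrMr ?mulr_gt0 // /m /theta.
  have rR : 0 <= r%:R :> R by exact: ler0n.
  move: gge q0; set q := (1 - p) ^+ r; set h : R := #|H|%:R.
  set g : R := #|G|%:R; set n : R := #|V|%:R.
  set D : R := (max_degree H)%:R => gge q0 nD.
  have a1 : q * (n * D) <= q * (K * (r%:R * h)) by rewrite ler_wpM2l // ltW.
  have a2 : K * r%:R * (q * h / 8) <= K * r%:R * g.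
    by rewrite ler_wpM2l // mulr_ge0 // ltW.
  nra.
(* Three times the cap [12 * theta] brings every weight below [1 / 3], the range of [expRN_le]. *)
pose d (v : V) : R := (degree G v)%:R / (36 * theta).
have c0 : 0 < 36 * theta by rewrite mulr_gt0.
have sumd (W : {set V}) :
    \sum_(v in W) d v = (\sum_(A in G) #|A :&: W|%:R) / (36 * theta).
  by rewrite -mulr_suml -!natr_sum sum_degree.
have sumdT : \sum_v d v = m / (36 * theta) by rewrite -mulr_suml mE.
apply: (@le_trans _ _ (expect p (fun W => expR (p * m / (72 * theta)) *
    ((S \subset W)%:R * expR (- \sum_(v in W) d v))))).
  apply: expect_le => // W; apply: natr_bool_le.
    by rewrite !mulr_ge0 ?expR_ge0.
  move=> /and3P[-> _ /forall_inP hit]; rewrite mul1r -expRD.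
  rewrite -[X in X <= _]expR0 ler_expR subr_ge0 sumd.
  have -> : p * m / (72 * theta) = (p * m / 2) / (36 * theta).
    by field; rewrite gt_eqF.
  rewrite ler_pM2r ?invr_gt0 //.
  have -> : p * m / 2 = \sum_(A in G) r%:R * p / 2.
    by rewrite sumr_const -mulr_natl /m; ring.
  apply: ler_sum => A AG; apply: hit.
  exact: (subsetP (missing_antimono _ sSW0)).
rewrite expectZ.
have dS v : v \in S -> d v = 0.
  by move=> /(subsetP sSW0) vW0; rewrite /d degree_missing0 ?mul0r.
have d01 v : 0 <= d v <= 1 / 3.
  apply/andP; split; first by rewrite divr_ge0 // ltW.
  rewrite ler_pdivrMr //.
  by apply: le_trans (dle v) _; lra.
apply: (@le_trans _ _ (expR (p * m / (72 * theta)) *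
    (p ^+ #|S| * expR (- (3 / 4 * p * \sum_v d v))))).
  by rewrite ler_pM2l ?expR_gt0 //; exact: expect_subset_expR.
rewrite mulrCA; apply: ler_wpM2l; first by rewrite exprn_ge0 // ltW.
rewrite -expRD ler_expR sumdT.
(* The event asks for half the mean while the moment bound gives three quarters of it, leaving a
   quarter. With [m_ge], [144 * 8] is the constant 1152. *)
have -> : p * m / (72 * theta) - 3 / 4 * p * (m / (36 * theta)) =
    - (p * (m / (144 * theta))) by field; rewrite gt_eqF.
have c1 : 0 < 144 * theta by rewrite mulr_gt0.
rewrite lerN2 -mulrA ler_pM2l // ler_pdivlMr //.
have K1 : K != 0 by rewrite gt_eqF.
apply: le_trans m_ge.
by rewrite le_eqVlt; apply/orP; left; apply/eqP; field.
Qed.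

(** * Union bound over small nets *)

(** Since [lam * expR lam^-1 >= 1], each term with [#|S|%:R < x] is at most
    [expR (x / lam) * (lam * p) ^+ #|S|]. Extending the sum to all subsets then gives
    [(1 + lam * p) ^+ #|V|]. *)
Lemma sum_small_subsets (R : realType) (V : finType) (p x lam : R) :
  0 <= p -> 0 < lam ->
  \sum_(S : {set V} | #|S|%:R < x) p ^+ #|S|
    <= expR (x / lam + lam * p * #|V|%:R).
Proof.
move=> p0 lam0.
apply: (@le_trans _ _ (expR (x / lam) *
    \sum_(S : {set V} | S \subset setT) (lam * p) ^+ #|S|)); last first.
  rewrite sum_subset_expr cardsT expRD ler_pM2l ?expR_gt0 //.
  have lp : 0 <= lam * p by rewrite mulr_ge0 // ltW.
  rewrite -[lam * p * _]mulrC expRM_natl.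
  by apply: lerXn2r; rewrite ?nnegrE ?expR_ge0 ?addr_ge0 ?expR_ge1Dx.
rewrite mulr_sumr [X in X <= _]big_mkcond [X in _ <= X]big_mkcond.
apply: ler_sum => S _; rewrite subsetT.
case: ifP => Sx; last first.
  by rewrite mulr_ge0 ?expR_ge0 // exprn_ge0 // mulr_ge0 // ltW.
rewrite exprMn mulrA -[X in X <= _]mul1r; apply: ler_wpM2r.
  exact: exprn_ge0.
apply: (@le_trans _ _ (expR lam^-1 ^+ #|S| * lam ^+ #|S|)).
  rewrite -exprMn; apply: exprn_ege1; rewrite -ler_pdivrMr // mul1r.
  have := expR_ge1Dx lam^-1; lra.
apply: ler_wpM2r; first by rewrite exprn_ge0 // ltW.
by rewrite -expRM_natl ler_expR ler_pM2r ?invr_gt0 // ltW.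
Qed.

Lemma random_subset_prob_gt0 (R : realType) (V : finType) (p : R)
    (E : pred {set V}) W :
  0 < p < 1 -> E W -> 0 < random_subset_prob p E.
Proof.
move=> p01 EW; rewrite /random_subset_prob (bigD1 W) //=.
apply: ltr_wpDr; last exact: (set_weight_gt0 W p01).
apply: sumr_ge0 => U _; apply: (set_weight_ge0 U).
by case/andP: p01 => ? ?; rewrite !ltW.
Qed.

(** An edge missing [S] with a larger trace would be large enough for the net property, because
    [eps * (2 * p * #|V|%:R)] equals [r%:R * p / 2]; then [S] would have to meet it. *)
Lemma eps_net_hits (R : realType) (V : finType) (r : nat) (H : {set {set V}})
    (p : R) (W S A : {set V}) :
  (0 < #|V|)%N -> #|W|%:R <= 2 * p * #|V|%:R ->
  eps_net (r%:R / (4 * #|V|%:R) : R) W (trace_hypergraph H W) S ->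
  A \in missing H S -> #|A :&: W|%:R <= r%:R * p / 2.
Proof.
move=> n0 cW /andP[sSW /forall_inP net]; rewrite inE => /andP[AH dAS].
rewrite leNgt; apply/negP => big.
have n0R : 0 < #|V|%:R :> R by rewrite ltr0n.
have /implyP := net _ (imset_f (fun A : {set V} => A :&: W) AH).
rewrite setIAC setI_eq0 => /(_ _)/negP; apply; last first.
  by rewrite -setI_eq0; move: dAS; rewrite -setI_eq0 => /eqP->; rewrite set0I.
apply: le_trans (ltW big).
apply: (@le_trans _ _ (r%:R / (4 * #|V|%:R) * (2 * p * #|V|%:R))).
  by rewrite ler_wpM2l // divr_ge0 // mulr_ge0 // ltW.
by rewrite le_eqVlt; apply/orP; left; apply/eqP; field; rewrite gt_eqF.
Qed.

(* A small net S(W) for every W would make the union bound over S exceed the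
   probability that W is typical. *)
Lemma exists_no_small_net (R : realType) (V : finType) (r : nat)
    (H : {set {set V}}) (p K : R) :
  linear_hypergraph H -> uniform r H -> almost_regular K H -> H != set0 ->
  0 < p -> p <= 2 / 3 -> (4 <= #|V|)%N -> 1 <= K ->
  1 <= (1 - p) ^+ r * (max_degree H)%:R ->
  #|V|%:R <= expR ((1 - p) ^+ r * (max_degree H)%:R) ->
  let kappa : R := (1152 * K)^-1 in
  1 <= kappa ^+ 2 / 16 * p * #|V|%:R ->
  exists2 W : {set V}, W != set0 & forall S,
    eps_net (r%:R / (4 * #|V|%:R) : R) W (trace_hypergraph H W) S ->
    kappa ^+ 2 / 16 * p * #|V|%:R <= #|S|%:R.
Proof.
move=> linH Hr HK H0 p0 p23 n4 K1 theta1 ntheta kappa big.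
have p1 : p < 1 by lra.
have p01 : 0 <= p <= 1 by lra.
have K0 : 0 < K by lra.
have n0 : (0 < #|V|)%N by exact: leq_trans n4.
have D0 : (0 < max_degree H)%N.
  by rewrite lt0n; apply: contraTneq theta1 => ->; rewrite mulr0 -ltNge.
have kappa0 : 0 < kappa by rewrite invr_gt0 mulr_gt0.
have kappaK : kappa * (1152 * K) = 1 by rewrite mulVf // gt_eqF // mulr_gt0.
set t : R := kappa ^+ 2 / 16 * p * #|V|%:R in big *.
pose small W := [exists S : {set V},
  eps_net (r%:R / (4 * #|V|%:R) : R) W (trace_hypergraph H W) S
  && (#|S|%:R < t)].
have [/existsP[W /andP[W0 smallW]] | allsmall] :=
    boolP [exists W : {set V}, (W != set0) && ~~ small W].
  exists W => // S netS; rewrite leNgt; apply: contra smallW => St.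
  by apply/existsP; exists S; rewrite netS.
exfalso.
pose bad (S W : {set V}) := [&& S \subset W, typical r H p W &
  [forall A in missing H S, #|A :&: W|%:R <= r%:R * p / 2]].
have cover W : (typical r H p W)%:R
    <= \sum_(S : {set V} | #|S|%:R < t) (bad S W)%:R :> R.
  apply: natr_bool_le => [|typW]; first exact: sumr_ge0.
  suff [S St badS] : exists2 S : {set V}, #|S|%:R < t & bad S W.
    by rewrite (bigD1 S) //= badS lerDl sumr_ge0.
  (* The contrary hypothesis covers only nonempty [W]. For the empty one, [S = set0] serves, as all
     traces are empty. *)
  have [W_0|W0] := eqVneq W set0.
    exists set0; first by rewrite cards0; lra.
    apply/and3P; split; rewrite ?sub0set //.
    apply/forall_inP => A _; rewrite W_0 setI0 cards0.
    by rewrite divr_ge0 // mulr_ge0 // ltW.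
  have /existsP[S /andP[netS St]] : small W.
    apply: contraNT allsmall => nsmall.
    by apply/existsP; exists W; rewrite W0.
  exists S => //; apply/and3P; split => //; first by case/andP: netS.
  apply/forall_inP => A AS; apply: eps_net_hits n0 _ netS AS.
  by case/and3P: typW.
have upper : expect p (fun W => (typical r H p W)%:R)
    <= expR (- (kappa / 2 * (p * #|V|%:R))).
  apply: le_trans (expect_le p01 cover) _; rewrite expect_sum.
  apply: (@le_trans _ _ (\sum_(S : {set V} | #|S|%:R < t)
      p ^+ #|S| * expR (- (p * #|V|%:R / (1152 * K))))).
    by apply: ler_sum => S _; exact: expect_subset_hitting.
  rewrite -mulr_suml -/kappa.
  (* [lam = kappa / 4] balances the two entropy terms: each is [kappa / 4 * p * #|V|%:R], so half of
     the decay rate [kappa] survives. *)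
  have k4 : 0 < kappa / 4 by rewrite divr_gt0.
  apply: (@le_trans _ _ (expR (t / (kappa / 4) + kappa / 4 * p * #|V|%:R) *
     expR (- (p * #|V|%:R * kappa)))).
    by rewrite ler_pM2r ?expR_gt0 //; apply: sum_small_subsets; rewrite // ltW.
  rewrite -expRD ler_expR.
  have -> : t / (kappa / 4) = kappa / 4 * p * #|V|%:R.
    by rewrite /t; field; rewrite gt_eqF.
  by rewrite le_eqVlt; apply/orP; left; apply/eqP; field.
have lower := expect_typical linH Hr HK H0 p0 p23 n4 theta1 ntheta (ltW K0).
move: upper lower; set P := expect _ _ => upper lower.
set x := kappa / 2 * (p * #|V|%:R) in upper.
(* [t] is [kappa * x / 8], so [t >= 1] makes [x] a large multiple of [K]; then [expR x >= 1 + x]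
   exceeds [96 * K], contradicting [lower]. *)
have xK : 4608 * K <= x.
  have : K * 1 <= K * t by rewrite ler_wpM2l // ltW.
  have -> : K * t = (kappa * (1152 * K)) / 9216 * x.
    by rewrite /t /x; field.
  rewrite kappaK; lra.
have := expR_ge1Dx x; have E0 := expR_gt0 x; rewrite expRN in upper.
have : 96 * K * P <= 96 * K * (expR x)^-1 by rewrite ler_wpM2l // mulr_ge0 // ltW.
move=> e1 e2; have : 1 <= 96 * K * (expR x)^-1 by lra.
by rewrite ler_pdivlMr // mul1r; lra.
Qed.

(* The conjunct W != set0 excludes the degenerate outcome V_p = set0: then
   set0 is an edge of size 0 >= eps * 0 that nothing intersects, so there are
   no eps-nets at all and the bound would hold vacuously, with probability
   (1 - p) ^+ #|V| > 0. *)
Theorem theorem1p2 (R : realType) :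
  exists C : R, forall K : R, 1 <= K ->
  exists2 alpha : R, 0 < alpha &
  forall (V : finType) (r : nat) (H : {set {set V}}) (p : R),
    H != set0 ->
    uniform r H ->
    almost_regular K H ->
    linear_hypergraph H ->
    0 < p -> p <= 2 / 3 ->
    C * ln #|V|%:R <= (1 - p) ^+ r * (max_degree H)%:R ->
    C * K <= p * #|V|%:R ->
    let eps : R := r%:R / (4 * #|V|%:R) in
    0 < random_subset_prob p (fun W : {set V} =>
      (W != set0) &&
      [forall S : {set V}, eps_net eps W (trace_hypergraph H W) S ==>
        (alpha * p * #|V|%:R <= #|S|%:R)]).
Proof.
(* The value 4 gives [#|V| >= 4] through [p * #|V|%:R >= 4 * K]; combined with [ln1] it also gives
   both [theta >= 1] and [#|V|%:R <= expR theta]. *)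
exists 4 => K K1; pose kappa : R := (1152 * K)^-1.
have kappa0 : 0 < kappa by rewrite invr_gt0 mulr_gt0 //; lra.
exists (kappa ^+ 2 / 16); first by rewrite divr_gt0 // exprn_gt0.
move=> V r H p H0 Hr HK linH p0 p23 lnD pn.
pose eps : R := r%:R / (4 * #|V|%:R).
have n4R : 4 <= #|V|%:R :> R.
  have : 0 <= #|V|%:R :> R by exact: ler0n.
  move: (#|V|%:R : R) pn => n pn n0; nra.
have n4 : (4 <= #|V|)%N by rewrite -(ler_nat R).
have p01 : 0 < p < 1 by lra.
suff [W W0 noS] : exists2 W : {set V}, W != set0 & forall S,
    eps_net eps W (trace_hypergraph H W) S ->
    kappa ^+ 2 / 16 * p * #|V|%:R <= #|S|%:R.
  apply: (@random_subset_prob_gt0 _ _ _ _ W) => //.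
  by rewrite W0; apply/forallP => S; apply/implyP/noS.
(* If the claimed bound is below 1, nets only have to be nonempty. [W = setT] ensures this: an edge
   has [r] vertices and the threshold is [r / 4]. *)
have [small|big] := ltP (kappa ^+ 2 / 16 * p * #|V|%:R) 1.
  exists setT => [|S /andP[_ /forall_inP net]].
    by rewrite -card_gt0 cardsT; exact: leq_trans n4.
  have [A AH] := set0Pn _ H0; apply: le_trans (ltW small) _.
  rewrite ler1n card_gt0; apply: contraTneq (net _ (imset_f _ AH)) => ->.
  rewrite setI0 eqxx implybF negbK setIT (Hr A AH) cardsT /eps.
  have -> : r%:R / (4 * #|V|%:R) * #|V|%:R = r%:R / 4 :> R.
    by field; rewrite gt_eqF //; lra.
  have : 0 <= r%:R :> R by exact: ler0n.
  lra.
(* From [ln y <= y - 1] at the inverse of [#|V|%:R], which is at most [1 / 4]. *)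
have ln1 : 3 / 4 <= ln (#|V|%:R : R).
  have n0 : 0 < #|V|%:R :> R by lra.
  have -> : #|V|%:R = (#|V|%:R^-1)^-1 :> R by rewrite invrK.
  rewrite lnV ?posrE ?invr_gt0 //.
  have i4 : #|V|%:R^-1 <= 4^-1 :> R by rewrite lef_pV2 ?posrE.
  have i0 : 0 < #|V|%:R^-1 :> R by rewrite invr_gt0.
  have := @le_ln1Dx R (#|V|%:R^-1 - 1); rewrite addrCA subrr addr0; lra.
apply: exists_no_small_net => //; first lra.
by rewrite -[X in X <= _]lnK ?posrE ?ler_expR; lra.
Qed.
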